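(* Let $X\in\mathbb{R}^8$ and let $X_0,\ldots,X_7\in\mathbb{R}^8$ be the twistor vectors of $X$. Then for any $i,j=0,1,\ldots,7$, in the Clifford algebra $C\ell_8$, $$X_iX_j+X_jX_i=-2|X|^2\delta_{ij}.$$
   Context: $\mathbb{O}$ is the (non-associative) real octonion algebra with basis $\mathbf{e}_0=1,\mathbf{e}_1,\ldots,\mathbf{e}_7$, where $\mathbf{e}_i\mathbf{e}_j+\mathbf{e}_j\mathbf{e}_i=-2\delta_{ij}$ for $1\le i,j\le 7$, and $\mathbf{e}_i\mathbf{e}_j=\mathbf{e}_k$ whenever $(i,j,k)$ is a cyclic permutation of one of $(1,2,3),(1,4,5),(1,7,6),(2,5,7),(2,4,6),(3,4,7),(3,6,5)$. Conjugation is $\overline{x_0+\sum_{i\ge1}x_i\mathbf{e}_i}=x_0-\sum_{i\ge1}x_i\mathbf{e}_i$ for real $x_i$. $\mathbb{R}^8$ has orthonormal basis $g_0,\ldots,g_7$ and Euclidean norm $|\cdot|$; $C\ell_8$ is the associative unital real Clifford algebra generated by $g_0,\ldots,g_7$ with $g_ig_j+g_jg_i=-2\delta_{ij}$, and $\mathbb{R}^8$ is regarded as a subspace of $C\ell_8$. $\Phi:\mathbb{R}^8\to\mathbb{O}$ is the linear isomorphism $\Phi(\sum_i x_ig_i)=\sum_i x_i\mathbf{e}_i$. The twistor vectors of $X\in\mathbb{R}^8$ are $X_i=\Phi^{-1}(\Phi(X)\overline{\mathbf{e}_i})\in\mathbb{R}^8$ for $i=0,\ldots,7$. *)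

(* Defs.v *)
From HB Require Import structures.
From mathcomp Require Import all_boot all_order all_algebra reals.

Set Implicit Arguments.
Unset Strict Implicit.
Unset Printing Implicit Defensive.

Import GRing.Theory Num.Theory.

Local Open Scope ring_scope.

(* The octonion sum_i x_i e_i is stored as the row of its coordinates.  The    *)
(* product is not associative, so octonions get no ring structure.             *)

Definition octonion (R : comNzRingType) : Type := 'rV[R]_8.

Definition oct_coord (R : comNzRingType) (x : octonion R) (i : 'I_8) : R :=
  (x : 'rV[R]_8) 0 i.

Definition oct_e (R : comNzRingType) (i : 'I_8) : octonion R :=
  delta_mx 0 i : 'rV[R]_8.

Definition oct_triples : seq (nat * nat * nat) :=
  [:: (1, 2, 3); (1, 4, 5); (1, 7, 6); (2, 5, 7); (2, 4, 6); (3, 4, 7);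
      (3, 6, 5)]%N.

Definition oct_cyclic (i j k : nat) : bool :=
  [|| (i, j, k) \in oct_triples, (j, k, i) \in oct_triples
    | (k, i, j) \in oct_triples].

(* Two distinct indices i, j >= 1 lie in exactly one triple, so exactly one    *)
(* term of the last sum is nonzero: e_i e_j = e_k if (i, j, k) is cyclic, and  *)
(* e_i e_j = - e_k if (j, i, k) is.                                            *)
Definition oct_emul (R : comNzRingType) (i j : 'I_8) : octonion R :=
  if i == 0 then oct_e R j
  else if j == 0 then oct_e R i
  else if i == j then - oct_e R 0
  else \sum_(k < 8) ((oct_cyclic i j k)%:R - (oct_cyclic j i k)%:R)
                       *: oct_e R k.

Definition oct_mul (R : comNzRingType) (x y : octonion R) : octonion R :=
  \sum_(i < 8) \sum_(j < 8) (oct_coord x i * oct_coord y j) *: oct_emul R i j.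

Definition oct_conj (R : comNzRingType) (x : octonion R) : octonion R :=
  oct_coord x 0 *: oct_e R 0 - \sum_(i < 8 | i != 0) oct_coord x i *: oct_e R i.

Section OctonionTheory.
Variable R : comNzRingType.
Local Notation e := (oct_e R).

Lemma oct_coordE (i j : 'I_8) : oct_coord (e i) j = (j == i)%:R.
Proof. by rewrite /oct_coord /oct_e mxE eqxx. Qed.

Lemma oct_mulee (i j : 'I_8) : oct_mul (e i) (e j) = oct_emul R i j.
Proof.
rewrite /oct_mul (bigD1 i) //= [X in _ + X]big1 ?addr0 => [|k nki].
  rewrite (bigD1 j) //= [X in _ + X]big1 ?addr0 => [|k nkj].
    by rewrite !oct_coordE !eqxx mulr1 scale1r.
  by rewrite !oct_coordE (negPf nkj) mulr0 scale0r.
by rewrite big1 // => l _; rewrite oct_coordE (negPf nki) mul0r scale0r.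
Qed.

Lemma oct_emul_cyclic (i j k : 'I_8) :
  oct_cyclic i j k -> oct_mul (e i) (e j) = e k.
Proof.
have H : all (fun i => all (fun j => all (fun k => oct_cyclic i j k ==>
     [&& i != 0, j != 0, i != j,
      all (fun l => oct_cyclic i j l == (l == k)) (iota 0 8)
    & all (fun l => ~~ oct_cyclic j i l) (iota 0 8)])
       (iota 0 8)) (iota 0 8)) (iota 0 8) by vm_compute.
have I (l : 'I_8) : (l : nat) \in iota 0 8 by rewrite mem_iota ltn_ord.
move=> c; move/allP/(_ _ (I i))/allP/(_ _ (I j))/allP/(_ _ (I k)): H.
rewrite c; case/and5P=> i0 j0 ij /allP h1 /allP h2.
have {}h1 (l : 'I_8) : oct_cyclic i j l = (l == k) by rewrite (eqP (h1 _ (I l))).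
have {}h2 (l : 'I_8) : oct_cyclic j i l = false by exact: negbTE (h2 _ (I l)).
rewrite oct_mulee /oct_emul -!val_eqE (negPf i0) (negPf j0) (negPf ij).
rewrite (bigD1 k) //= big1 ?addr0 => [|l nlk].
  by rewrite h2 h1 eqxx subr0 scale1r.
by rewrite h2 h1 (negPf nlk) subr0 scale0r.
Qed.

Lemma oct_emul_anticomm (i j : 'I_8) : i != 0 -> j != 0 ->
  oct_mul (e i) (e j) + oct_mul (e j) (e i) = (- 2 * (i == j)%:R) *: e 0.
Proof.
move=> /negPf i0 /negPf j0; rewrite !oct_mulee /oct_emul i0 j0 eq_sym.
case: eqVneq => _.
  by rewrite mulr1 scaleNr -opprD -[e 0]scale1r -scalerDl scale1r.
rewrite mulr0 scale0r -big_split /= big1 // => k _.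
by rewrite -scalerDl subrKA subrr scale0r.
Qed.

End OctonionTheory.

Definition Phi (R : comNzRingType) (X : 'rV[R]_8) : octonion R :=
  \sum_(i < 8) X 0 i *: oct_e R i.

Definition Phi_inv (R : comNzRingType) (x : octonion R) : 'rV[R]_8 :=
  \sum_(i < 8) oct_coord x i *: delta_mx 0 i.

Lemma PhiK (R : comNzRingType) : cancel (@Phi R) (@Phi_inv R).
Proof. by move=> X; rewrite /Phi_inv /Phi -!row_sum_delta. Qed.

Lemma Phi_invK (R : comNzRingType) : cancel (@Phi_inv R) (@Phi R).
Proof. by move=> X; rewrite /Phi_inv /Phi -!row_sum_delta. Qed.

Definition twistor (R : comNzRingType) (X : 'rV[R]_8) (i : 'I_8) : 'rV[R]_8 :=
  Phi_inv (oct_mul (Phi X) (oct_conj (oct_e R i))).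

(* The library's norm on matrices is the sup norm, hence this definition.      *)
Definition enorm (R : realType) (n : nat) (X : 'rV[R]_n) : R :=
  Num.sqrt (\sum_(i < n) X 0 i ^+ 2).

(* The Clifford algebra of the negative definite form on R^n, on its standard  *)
(* basis: the element indexed by A : {set 'I_n} stands for the product of the  *)
(* g_a, a in A, taken in increasing order of a (see cl_basis_prod), so that    *)
(* the algebra has dimension 2 ^ n.                                            *)
Definition clifford (R : comNzRingType) (n : nat) : Type :=
  {ffun {set 'I_n} -> R^o}.

HB.instance Definition _ (R : comNzRingType) (n : nat) :=
  GRing.Lmodule.on (clifford R n).

Definition symdiff (T : finType) (A B : {set T}) : {set T} :=
  (A :\: B) :|: (B :\: A).

(* Reordering g_A g_B increasingly costs a factor -1 for every pair a > b (a   *)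
(* transposition of g_a and g_b) and for every pair a = b (g_a g_a = -1).      *)
Definition cl_sign (R : comNzRingType) (n : nat) (A B : {set 'I_n}) : R :=
  \prod_(a in A) \prod_(b in B | (b <= a)%N) (- 1).

Definition cl_basis (R : comNzRingType) (n : nat) (A : {set 'I_n}) :
    clifford R n :=
  [ffun B => (B == A)%:R].

Definition cl_mul (R : comNzRingType) (n : nat) (x y : clifford R n) :
    clifford R n :=
  \sum_(A : {set 'I_n}) \sum_(B : {set 'I_n})
     (x A * y B * cl_sign R A B) *: cl_basis R (symdiff A B).

Section CliffordRing.
Variables (R : comNzRingType) (n : nat).
Implicit Types (x y z : clifford R n) (A B C : {set 'I_n}).
Local Notation sg := (@cl_sign R n).
Local Notation "A +^ B" := (symdiff A B) (at level 50, left associativity).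

Lemma in_symdiff A B i : (i \in A +^ B) = (i \in A) (+) (i \in B).
Proof. by rewrite !inE; case: (i \in A); case: (i \in B). Qed.

Lemma symdiffA : associative (@symdiff 'I_n).
Proof. by move=> A B C; apply/setP=> i; rewrite !in_symdiff addbA. Qed.

Lemma symdiffK A : involutive (symdiff A).
Proof. by move=> B; apply/setP=> i; rewrite !in_symdiff addKb. Qed.

Lemma symdiff0s A : set0 +^ A = A.
Proof. by apply/setP=> i; rewrite in_symdiff inE. Qed.

Lemma symdiffs0 A : A +^ set0 = A.
Proof. by apply/setP=> i; rewrite in_symdiff inE addbF. Qed.

Lemma symdiffss A : A +^ A = set0.
Proof. by apply/setP=> i; rewrite in_symdiff inE addbb. Qed.

Lemma prod_symdiff A B (f : 'I_n -> R) : (forall i, f i * f i = 1) ->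
  \prod_(i in A +^ B) f i = \prod_(i in A) f i * \prod_(i in B) f i.
Proof.
move=> ff; rewrite ![\prod_(i in _) _]big_mkcond -big_split /=.
apply: eq_bigr => i _; rewrite in_symdiff.
by case: (i \in A); case: (i \in B); rewrite /= ?mul1r ?mulr1 ?ff.
Qed.

Lemma cl_sign_row a B : let f := \prod_(b in B | (b <= a)%N) (- 1) : R in
  f * f = 1.
Proof. by rewrite /= -big_split /= big1 // => b _; rewrite mulrNN mulr1. Qed.

Lemma cl_signDl A B C : sg (A +^ B) C = sg A C * sg B C.
Proof. by apply: prod_symdiff => a; apply: cl_sign_row. Qed.

Lemma cl_signDr A B C : sg A (B +^ C) = sg A B * sg A C.
Proof.
rewrite /cl_sign -big_split /=; apply: eq_bigr => a _.
rewrite !big_mkcondr; apply: prod_symdiff => b.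
by case: ifP; rewrite ?mulrNN mulr1.
Qed.

Lemma cl_sign0s A : sg set0 A = 1. Proof. exact: big_set0. Qed.

Lemma cl_signs0 A : sg A set0 = 1.
Proof. by apply: big1 => a _; rewrite big_pred0 // => b; rewrite inE. Qed.

Lemma cl_mulE x y C :
  cl_mul x y C = \sum_A x A * y (A +^ C) * sg A (A +^ C).
Proof.
rewrite /cl_mul sum_ffunE; apply: eq_bigr => A _.
rewrite sum_ffunE (bigD1 (A +^ C)) //= big1 ?addr0 => [|B nB].
  by rewrite !ffunE symdiffK eqxx; apply: mulr1.
rewrite !ffunE; case: eqP => [E|_]; last exact: mulr0.
by rewrite E symdiffK eqxx in nB.
Qed.

Lemma cl_mulA : associative (@cl_mul R n).
Proof.
move=> x y z; apply/ffunP => C; rewrite !cl_mulE.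
under eq_bigr => A _ do rewrite cl_mulE mulr_sumr mulr_suml.
under [RHS]eq_bigr => D _ do rewrite cl_mulE !mulr_suml.
rewrite [RHS]exchange_big /=; apply: eq_bigr => A _.
rewrite [RHS](reindex_inj (inv_inj (symdiffK A))) /=; apply: eq_bigr => E _.
rewrite symdiffK.
have -> : E +^ (A +^ C) = (A +^ E) +^ C.
  by apply/setP=> i; rewrite !in_symdiff !addbA (addbC (i \in E)).
have -> : A +^ C = E +^ (A +^ E +^ C).
  apply/setP=> i; rewrite !in_symdiff.
  by case: (i \in A); case: (i \in E); case: (i \in C).
set F := A +^ E +^ C; rewrite cl_signDr cl_signDl.
rewrite -!mulrA; congr (_ * (_ * _)); rewrite [RHS]mulrCA; congr (_ * _).
by rewrite mulrC mulrA.
Qed.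

Lemma cl_mul1x : left_id (cl_basis R set0) (@cl_mul R n).
Proof.
move=> x; apply/ffunP => C; rewrite cl_mulE (bigD1 set0) //= big1 ?addr0.
  by rewrite ffunE eqxx symdiff0s cl_sign0s mul1r mulr1.
by move=> A nA; rewrite ffunE (negPf nA) !mul0r.
Qed.

Lemma cl_mulx1 : right_id (cl_basis R set0) (@cl_mul R n).
Proof.
move=> x; apply/ffunP => C; rewrite cl_mulE (bigD1 C) //= big1 ?addr0.
  by rewrite ffunE symdiffss eqxx cl_signs0 !mulr1.
move=> A nA; rewrite ffunE; case: eqP => [E|_]; last by rewrite mulr0 mul0r.
by case/eqP: nA; rewrite -[C](symdiffK A) E symdiffs0.
Qed.

Lemma cl_mulDl : left_distributive (@cl_mul R n) +%R.
Proof.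
move=> x y z; apply/ffunP => C; rewrite [RHS]ffunE !cl_mulE -big_split /=.
by apply: eq_bigr => A _; rewrite ffunE !mulrDl.
Qed.

Lemma cl_mulDr : right_distributive (@cl_mul R n) +%R.
Proof.
move=> x y z; apply/ffunP => C; rewrite [RHS]ffunE !cl_mulE -big_split /=.
by apply: eq_bigr => A _; rewrite ffunE mulrDr mulrDl.
Qed.

Lemma cl_one_neq0 : cl_basis R (set0 : {set 'I_n}) != 0.
Proof.
apply/eqP => /ffunP/(_ set0); rewrite !ffunE eqxx.
by apply/eqP; apply: oner_neq0.
Qed.

End CliffordRing.

HB.instance Definition _ (R : comNzRingType) (n : nat) :=
  GRing.Zmodule_isNzRing.Build (clifford R n)
    (@cl_mulA R n) (@cl_mul1x R n) (@cl_mulx1 R n)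
    (@cl_mulDl R n) (@cl_mulDr R n) (@cl_one_neq0 R n).

Lemma cl_scaleAl (R : comNzRingType) (n : nat) (a : R) (x y : clifford R n) :
  a *: (x * y) = (a *: x) * y.
Proof.
apply/ffunP => C; rewrite ffunE [in LHS]cl_mulE [RHS]cl_mulE scaler_sumr.
apply: eq_bigr => A _; rewrite [in RHS]ffunE.
by rewrite /GRing.scale /= !mulrA.
Qed.

HB.instance Definition _ (R : comNzRingType) (n : nat) :=
  GRing.Lmodule_isLalgebra.Build R (clifford R n) (@cl_scaleAl R n).

Lemma cl_scaleAr (R : comNzRingType) (n : nat) (a : R) (x y : clifford R n) :
  a *: (x * y) = x * (a *: y).
Proof.
apply/ffunP => C; rewrite ffunE [in LHS]cl_mulE [RHS]cl_mulE scaler_sumr.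
apply: eq_bigr => A _; rewrite [in RHS]ffunE; rewrite /GRing.scale /=.
by rewrite !mulrA (mulrC a).
Qed.

HB.instance Definition _ (R : comNzRingType) (n : nat) :=
  GRing.Lalgebra_isAlgebra.Build R (clifford R n) (@cl_scaleAr R n).

Definition cl_gen (R : comNzRingType) (n : nat) (i : 'I_n) : clifford R n :=
  cl_basis R [set i].

(* The inclusion of R^n into its Clifford algebra.                             *)
Definition cl_vec (R : comNzRingType) (n : nat) (X : 'rV[R]_n) : clifford R n :=
  \sum_(i < n) X 0 i *: cl_gen R i.

Section CliffordTheory.
Variables (R : comNzRingType) (n : nat).
Implicit Types (A B : {set 'I_n}).

Lemma cl_basisM A B :
  cl_basis R A * cl_basis R B = cl_sign R A B *: cl_basis R (symdiff A B).
Proof.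
apply/ffunP => C; rewrite [LHS]cl_mulE (bigD1 A) //= big1 ?addr0; last first.
  by move=> D nD; rewrite ffunE (negPf nD) !mul0r.
rewrite !ffunE eqxx mul1r [RHS]mulrC.
case: eqP => [<-|n1]; first by rewrite symdiffK eqxx.
by case: eqP => [E|]; rewrite ?mul0r //; case: n1; rewrite E symdiffK.
Qed.

Lemma cl_genM (i j : 'I_n) :
  cl_gen R i * cl_gen R j + cl_gen R j * cl_gen R i = (- 2 * (i == j)%:R)%:A.
Proof.
have sg (a b : 'I_n) :
    cl_sign R [set a] [set b] = if (b <= a)%N then - 1 else 1.
  by rewrite /cl_sign big_set1 big_mkcondr big_set1.
rewrite /cl_gen !cl_basisM !sg.
have -> : symdiff [set j] [set i] = symdiff [set i] [set j].
  exact: setUC.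
rewrite -scalerDl; case: eqVneq => [->|nij].
  by rewrite leqnn symdiffss mulr1 -opprD.
rewrite mulr0 scale0r; have := nij; rewrite -val_eqE /=.
by case: ltngtP => // _ _; rewrite ?subrr ?addNr scale0r.
Qed.

Lemma cl_basis_prod A : cl_basis R A = \prod_(a in A) cl_gen R a.
Proof.
suff H (s : seq 'I_n) : sorted ltn (map val s) -> {subset A <= s} ->
    cl_basis R A = \prod_(a <- s | a \in A) cl_gen R a.
  rewrite (H (enum 'I_n)) => [||a _]; last exact: mem_enum.
    by rewrite enumT [index_enum _]unlock.
  by rewrite val_enum_ord iota_ltn_sorted.
elim: s A => [|a s IH] A /= Hs sA.
  rewrite big_nil (_ : A = set0) //; apply/setP=> i.
  by rewrite inE; apply/negP=> /sA.
have gta b : b \in s -> (a < b)%N.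
  move=> bs; move: Hs; rewrite path_sortedE; last exact: ltn_trans.
  by case/andP=> /allP h _; apply: h; apply: map_f.
have sB : {subset A :\ a <= s}.
  by move=> i; rewrite !inE => /andP[/negPf ia /sA]; rewrite inE ia.
have {}IH := IH _ (path_sorted Hs) sB.
have E : cl_basis R (A :\ a) = \prod_(b <- s | b \in A) cl_gen R b.
  rewrite IH big_seq_cond [RHS]big_seq_cond; apply: eq_bigl => b; case bs : (b \in s) => //=.
  by rewrite !inE -val_eqE gtn_eqF ?gta.
rewrite big_cons -E; case: ifPn => aA; last first.
  congr cl_basis; apply/setP=> i; rewrite !inE.
  by case: eqP => [->|//]; apply/negbTE.
rewrite cl_basisM (_ : cl_sign R _ _ = 1) ?scale1r.
  congr (cl_basis R _); apply/setP=> i; rewrite in_symdiff !inE.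
  by case: eqVneq => [->|]; rewrite ?aA.
rewrite /cl_sign big_set1 big_pred0 // => b.
by apply/negbTE/negP => /andP[/sB/gta ab]; rewrite leqNgt ab.
Qed.

(* The ring structure is that of the Clifford algebra, not the pointwise one   *)
(* that the library puts on finite functions.                                  *)
Lemma clifford_mulE (x y : clifford R n) : x * y = cl_mul x y.
Proof. by []. Qed.

Lemma clifford_oneE : 1 = cl_basis R set0 :> clifford R n.
Proof. by []. Qed.

End CliffordTheory.

(* Main.v *)
(** Polarizing the Clifford relations gives [X Y + Y X = -2 <X, Y>] for all
    vectors, so it suffices that [<X_i, X_j> = |X|^2 delta_ij].  Expanding in the
    coordinates of [X], this is the polarized composition law
      [<e_a e_i^*, e_b e_j^*> + <e_b e_i^*, e_a e_j^*> = 2 delta_ab delta_ij],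
    an identity between integers which is checked on the multiplication table. *)
Require Import Defs.
From mathcomp Require Import all_boot all_order all_algebra reals.

Import GRing.Theory Num.Theory.
Local Open Scope ring_scope.

Definition dotmul {R : comNzRingType} {n : nat} (X Y : 'rV[R]_n) : R :=
  \sum_(k < n) X 0 k * Y 0 k.

Lemma enorm_sqr {R : realType} {n : nat} (X : 'rV[R]_n) :
  enorm X ^+ 2 = dotmul X X.
Proof. by rewrite sqr_sqrtr // sumr_ge0 // => k _; apply: sqr_ge0. Qed.

Lemma cl_vec_anticomm {R : comNzRingType} {n : nat} (X Y : 'rV[R]_n) :
  cl_vec X * cl_vec Y + cl_vec Y * cl_vec X = (- 2 * dotmul X Y)%:A.
Proof.
have cl_vecM (V W : 'rV[R]_n) : cl_vec V * cl_vec W =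
    \sum_k \sum_l (V 0 k * W 0 l) *: (cl_gen R k * cl_gen R l).
  rewrite mulr_suml; apply: eq_bigr => k _; rewrite mulr_sumr.
  by apply: eq_bigr => l _; rewrite -scalerAl -scalerAr scalerA.
(* Swapping the sums of the second product pairs [g_k g_l] with [g_l g_k] under the same
   coefficient; only [l = k] survives. *)
rewrite !cl_vecM [X in _ + X]exchange_big -big_split mulr_sumr scaler_suml /=.
apply: eq_bigr => k _; rewrite -big_split (bigD1 k) //= big1 ?addr0 => [|l nlk].
  by rewrite [Y 0 k * _]mulrC -scalerDr cl_genM eqxx mulr1 scalerA mulrC.
rewrite [Y 0 l * _]mulrC -scalerDr cl_genM eq_sym (negPf nlk).
by rewrite mulr0 scale0r scaler0.
Qed.

(* The coefficient of [e_k] in [e_a * conj e_i], for indices below 8. *)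
Definition twistor_coef (a i k : nat) : int :=
  if i == 0%N then (k == a)%:R
  else if a == 0%N then - (k == i)%:R
  else if a == i then (k == 0%N)%:R
  else (oct_cyclic i a k)%:R - (oct_cyclic a i k)%:R.

Lemma oct_conj_e {R : comNzRingType} (i : 'I_8) :
  oct_conj (oct_e R i) = (if i == 0 then 1 else - 1 : R) *: oct_e R i.
Proof.
rewrite /oct_conj oct_coordE eq_sym; case: eqVneq => [->|ni0].
  rewrite big1 ?subr0 // => k nk0.
  by rewrite oct_coordE (negPf nk0) scale0r.
rewrite scale0r sub0r scaleN1r (bigD1 i) //= big1 ?addr0 => [|k /andP[_ nki]].
  by rewrite oct_coordE eqxx scale1r.
by rewrite oct_coordE (negPf nki) scale0r.
Qed.

(** The sign in front is that of [conj e_i]: it cancels the minus of [e_i e_i = - e_0] and reverses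
    the difference of the cyclic indicators. The coefficients become integers independent of [R],
    hence computable. *)
Lemma oct_emul_coord {R : comNzRingType} (a i k : 'I_8) :
  (if i == 0 then 1 else - 1) * oct_coord (oct_emul R a i) k
  = (twistor_coef a i k)%:~R.
Proof.
have coord_sum (c : 'I_8 -> R) :
    oct_coord (\sum_l c l *: oct_e R l) k = c k.
  rewrite /oct_coord summxE (bigD1 k) //= big1 ?addr0 => [|l nlk].
    by rewrite !mxE !eqxx mulr1.
  by rewrite !mxE eqxx eq_sym (negPf nlk) mulr0.
rewrite /oct_emul /twistor_coef -[i == 0 :> 'I_8]val_eqE -[a == 0 :> 'I_8]val_eqE.
rewrite -[a == i]val_eqE /=; case: eqVneq => [i0|ni0].
  have -> : i = 0 by apply: val_inj.
  rewrite mul1r; case: eqVneq => [a0|_]; last by rewrite oct_coordE rmorph_nat.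
  have -> : a = 0 by apply: val_inj.
  by rewrite oct_coordE rmorph_nat.
rewrite mulN1r; case: eqVneq => _.
  by rewrite oct_coordE rmorphN rmorph_nat.
case: eqVneq => _; last by rewrite coord_sum opprB rmorphB !rmorph_nat.
by rewrite {1}/oct_coord mxE opprK -/(oct_coord _ _) oct_coordE rmorph_nat.
Qed.

Lemma twistorE {R : comNzRingType} (X : 'rV[R]_8) (i k : 'I_8) :
  twistor X i 0 k = \sum_a X 0 a * (twistor_coef a i k)%:~R.
Proof.
(* [Phi] and [Phi_inv] preserve coordinates, and [conj e_i] is a multiple of [e_i], so only the term
   [l = i] of the product remains. *)
rewrite /twistor /Phi_inv -row_sum_delta /Phi -row_sum_delta oct_conj_e.
rewrite /oct_mul summxE; apply: eq_bigr => a _.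
rewrite summxE (bigD1 i) //= big1 ?addr0 => [|l nli]; last first.
  by rewrite /oct_coord /oct_e !mxE (negPf nli) !mulr0 mul0r.
rewrite -oct_emul_coord /oct_coord /oct_e !mxE !eqxx mulr1.
by rewrite mulrA.
Qed.

Lemma twistor_coef_composition (a b i j : 'I_8) :
  \sum_(k < 8) (twistor_coef a i k * twistor_coef b j k
              + twistor_coef b i k * twistor_coef a j k)
  = ((a == b) && (i == j))%:R *+ 2.
Proof.
pose f (a b i j k : nat) := twistor_coef a i k * twistor_coef b j k
  + twistor_coef b i k * twistor_coef a j k.
(* Big operators are locked, so the sum is restated as a [foldr] over natural numbers, which
   [vm_compute] can evaluate in all [8 ^ 4] cases. *)
pose sum8 (g : nat -> int) := foldr (fun k s => g k + s) 0 (iota 0 8).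
have I8 (l : 'I_8) : (l : nat) \in iota 0 8 by rewrite mem_iota ltn_ord.
have table : all (fun a => all (fun b => all (fun i => all (fun j =>
    sum8 (f a b i j) == ((a == b) && (i == j))%:R *+ 2)
    (iota 0 8)) (iota 0 8)) (iota 0 8)) (iota 0 8).
  by vm_compute.
move/allP/(_ _ (I8 a))/allP/(_ _ (I8 b)): table.
move/allP/(_ _ (I8 i))/allP/(_ _ (I8 j))/eqP => <-.
by rewrite -(big_mkord xpredT (f a b i j)) unlock.
Qed.

(** Stated doubled because the composition law controls only symmetrized products and 2 may not be
    cancellable in [R]; the 2 of the Clifford relation absorbs the factor. *)
Lemma twistor_dotmul {R : comNzRingType} (X : 'rV[R]_8) (i j : 'I_8) :
  dotmul (twistor X i) (twistor X j) *+ 2 = dotmul X X * (i == j)%:R *+ 2.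
Proof.
pose G (a b : 'I_8) : R :=
  \sum_(k < 8) (twistor_coef a i k)%:~R * (twistor_coef b j k)%:~R.
have dotE : dotmul (twistor X i) (twistor X j)
    = \sum_a \sum_b X 0 a * X 0 b * G a b.
  under [RHS]eq_bigr => a _ do under eq_bigr => b _ do rewrite mulr_sumr.
  under [RHS]eq_bigr => a _ do rewrite exchange_big.
  rewrite [RHS]exchange_big; apply: eq_bigr => k _ /=.
  rewrite !twistorE mulr_suml; apply: eq_bigr => a _.
  by rewrite mulr_sumr; apply: eq_bigr => b _; rewrite mulrACA.
have GE a b : G a b + G b a = ((a == b) && (i == j))%:R *+ 2.
  rewrite -big_split /=.
  have := congr1 (intr : int -> R) (twistor_coef_composition a b i j).
  rewrite rmorphMn rmorph_nat rmorph_sum /= => <-.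
  by apply: eq_bigr => k _; rewrite rmorphD !rmorphM.
(* Exchanging [a] and [b] in one of the two copies makes [G a b + G b a] appear. *)
rewrite mulr2n dotE {1}exchange_big -big_split mulr_suml -sumrMnl /=.
apply: eq_bigr => a _; rewrite -big_split (bigD1 a) //= big1 ?addr0 => [|b nba].
  by rewrite -mulrDr GE eqxx mulrnAr.
by rewrite (mulrC (X 0 b)) -mulrDr GE (negPf nba) mul0rn mulr0.
Qed.

Theorem lemma4p13 (R : realType) (X : 'rV[R]_8) (i j : 'I_8) :
  cl_vec (twistor X i) * cl_vec (twistor X j)
    + cl_vec (twistor X j) * cl_vec (twistor X i)
  = (- 2 * enorm X ^+ 2 * (i == j)%:R)%:A :> clifford R 8.
Proof.
rewrite cl_vec_anticomm enorm_sqr; congr (_ *: _).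
by rewrite -mulrA !mulNr !mulr_natl twistor_dotmul.
Qed.
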